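(* Let $n$ be a real number with $n\notin\{0,1\}$ and let $a_1(t),a_2(t)$ be arbitrary real $t$-dependent functions. Consider the complex Bernoulli differential equation $$\frac{\mathrm{d}w}{\mathrm{d}t}=a_1(t)w+a_2(t)w^n$$ for a complex function $w(t)$. In polar coordinates $w=r\mathrm{e}^{\mathrm{i}\theta}$ it becomes the first-order coupled system $$\frac{\mathrm{d}r}{\mathrm{d}t}=a_1(t)\,r+a_2(t)\,r^n\cos[(n-1)\theta],\qquad \frac{\mathrm{d}\theta}{\mathrm{d}t}=a_2(t)\,r^{n-1}\sin[(n-1)\theta].$$ An explicit solution of this system is $$r(t)=\left(\frac{c_1\,\mathrm{e}^{\gamma(t)}}{\sqrt{1+(n-1)^2c_1^2\left(c_2+\int_a^t \mathrm{e}^{\gamma(s)}a_2(s)\,\mathrm{d}s\right)^2}}\right)^{\frac{1}{n-1}},\qquad \gamma(t)=(n-1)\int_a^t a_1(\tau)\,\mathrm{d}\tau,$$ $$\theta(t)=-\frac{1}{n-1}\arctan\left(\frac{1}{(n-1)\,c_1\left(c_2+\int_a^t \mathrm{e}^{\gamma(s)}a_2(s)\,\mathrm{d}s\right)}\right),$$ where $c_1,c_2$ are integration constants. That the system is satisfied is checked by observing that $$\sqrt{(n-1)^2c_1^2\left(c_2+\int_a^t \mathrm{e}^{\gamma(s)}a_2(s)\,\mathrm{d}s\right)^2}=-(n-1)c_1\left(c_2+\int_a^t \mathrm{e}^{\gamma(s)}a_2(s)\,\mathrm{d}s\right),$$ i.e. with the choice of the negative square root.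
   Context: The constants $c_1,c_2$ are determined by the initial conditions, and $a$ is an appropriate real number ensuring the existence of the integrals over the compact interval $[a,t]$. The solution comes from the change of variables $x=\frac{r^{n-1}}{\sin[(n-1)\theta]}$, $y=\frac{\cos[(n-1)\theta]}{(1-n)r^{n-1}}$, which reduces the polar system to the linear system $\dot x=(n-1)a_1(t)x$, $\dot y=-(n-1)a_1(t)y+a_2(t)$. The choice of square root follows from the relation $\sqrt{(n-1)^2x^2y^2}=-(n-1)xy=\frac{1}{\tan[(n-1)\theta]}$.
   Formalization: The explicit solution is claimed only at times where a_1 and a_2 are continuous, with c_1>0, a nonzero value of c_2 plus the integral, and c_1, c_2, t such that the displayed negative-root identity holds for the ordinary nonnegative root. *)

(* Defs.v *)
From Stdlib Require Export Reals.
From Coquelicot Require Export Coquelicot.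
Open Scope R_scope.

Definition Cexp (z : C) : C :=
  (exp (Re z) * cos (Im z), exp (Re z) * sin (Im z)).

(* w ^ n = exp (n log w) for a real exponent n, where the branch
   log w = ln |w| + i theta is selected by an argument theta of w <> 0.
   For integer n the value does not depend on the choice of theta. *)
Definition Cpow_arg (n theta : R) (w : C) : C :=
  Cexp (RtoC n * (RtoC (ln (Cmod w)) + Ci * RtoC theta))%C.

(* The derivative is that of a C-valued function of the real variable t, hence
   C is taken as a normed module over R. The branch of w ^ n follows the
   argument [theta] of w. *)
Definition complex_bernoulli_at
  (n : R) (a1 a2 : R -> R) (theta : R -> R) (w : R -> C) (t : R) : Prop :=
  @is_derive R_AbsRing C_R_NormedModule w t
    (RtoC (a1 t) * w t + RtoC (a2 t) * Cpow_arg n (theta t) (w t))%C.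

Definition polar_bernoulli_at
  (n : R) (a1 a2 : R -> R) (r theta : R -> R) (t : R) : Prop :=
  is_derive r t
    (a1 t * r t + a2 t * Rpower (r t) n * cos ((n - 1) * theta t)) /\
  is_derive theta t
    (a2 t * Rpower (r t) (n - 1) * sin ((n - 1) * theta t)).

Definition gamma (n : R) (a1 : R -> R) (a t : R) : R :=
  (n - 1) * RInt a1 a t.

(* The factor c2 + int_a^t exp (gamma s) a2 s ds. *)
Definition shifted_integral
  (n : R) (a1 a2 : R -> R) (a c2 t : R) : R :=
  c2 + RInt (fun s => exp (gamma n a1 a s) * a2 s) a t.

(* [Rpower] is the real power only for a positive base, i.e. for 0 < c1. *)
Definition r_sol (n : R) (a1 a2 : R -> R) (a c1 c2 t : R) : R :=
  Rpower
    (c1 * exp (gamma n a1 a t) /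
       sqrt (1 + (n - 1) ^ 2 * c1 ^ 2 * shifted_integral n a1 a2 a c2 t ^ 2))
    (1 / (n - 1)).

Definition theta_sol (n : R) (a1 a2 : R -> R) (a c1 c2 t : R) : R :=
  - (1 / (n - 1)) *
    atan (1 / ((n - 1) * c1 * shifted_integral n a1 a2 a c2 t)).

(* The negative square root is the one chosen in sqrt (A ^ 2) = - A, where
   A = (n - 1) c1 (c2 + int_a^t exp (gamma s) a2 s ds); this restricts c1, c2
   and t, since it amounts to A <= 0. *)
Definition negative_root_at
  (n : R) (a1 a2 : R -> R) (a c1 c2 t : R) : Prop :=
  sqrt ((n - 1) ^ 2 * c1 ^ 2 * shifted_integral n a1 a2 a c2 t ^ 2) =
  - ((n - 1) * c1 * shifted_integral n a1 a2 a c2 t).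

(* Main.v *)
(** Dividing w' = a1 w + a2 w^n by e^(i theta) gives
    r' + i r theta' = a1 r + a2 r^n e^(i (n-1) theta), whose real and imaginary
    parts are the polar system. For the solution put m = n - 1 and
    A = m c1 (c2 + int_a^t e^gamma a2). As A < 0, phi = m theta = - atan (1/A)
    lies in (0, pi/2), with cos phi = - A / sqrt (1 + A^2) and
    sin phi = 1 / sqrt (1 + A^2), while r^m = c1 e^gamma / sqrt (1 + A^2) and
    A' = m c1 e^gamma a2. *)

From Stdlib Require Import Lra.
Require Import Defs.

(** * Polar form of complex numbers and their real powers *)

Lemma Cexp_Ci (x : R) : Cexp (Ci * RtoC x) = (cos x, sin x).
Proof.
  unfold Cexp, Ci, RtoC, Cmult, Re, Im; simpl.
  replace (0 * x - 1 * 0) with 0 by ring.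
  replace (0 * 0 + 1 * x) with x by ring.
  now rewrite exp_0, !Rmult_1_l.
Qed.

Lemma polarE (r x : R) :
  (RtoC r * Cexp (Ci * RtoC x))%C = (r * cos x, r * sin x).
Proof.
  rewrite Cexp_Ci; unfold RtoC, Cmult; simpl; f_equal; ring.
Qed.

Lemma Cmod_polar (r x : R) : 0 < r -> Cmod (r * cos x, r * sin x) = r.
Proof.
  intros Hr; unfold Cmod; simpl fst; simpl snd.
  replace ((r * cos x) ^ 2 + (r * sin x) ^ 2)
    with (r ^ 2 * (Rsqr (sin x) + Rsqr (cos x))) by (unfold Rsqr; ring).
  rewrite sin2_cos2, Rmult_1_r; apply sqrt_pow2; lra.
Qed.

(** The branch of the logarithm is the one with argument x itself, so n log w = n ln r + i n x for
    every real x, with no reduction modulo 2 pi. *)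
Lemma Cpow_arg_polar (n r x : R) : 0 < r ->
  Cpow_arg n x (r * cos x, r * sin x) =
  (Rpower r n * cos (n * x), Rpower r n * sin (n * x)).
Proof.
  intros Hr; unfold Cpow_arg; rewrite Cmod_polar by assumption.
  unfold Cexp, Ci, RtoC, Cmult, Cplus, Re, Im, Rpower; simpl.
  replace (n * (ln r + (0 * x - 1 * 0)) - 0 * (0 + (0 * 0 + 1 * x)))
    with (n * ln r) by ring.
  replace (n * (0 + (0 * 0 + 1 * x)) + 0 * (ln r + (0 * x - 1 * 0)))
    with (n * x) by ring.
  reflexivity.
Qed.

(** * Differentiation in polar coordinates *)

(** The two projections are linear and so preserve derivatives; conversely w is the sum of Re w
    times (1, 0) and Im w times (0, 1), with constant vectors. *)
Lemma is_derive_C_iff (w : R -> C) (t : R) (l : C) :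
  @is_derive R_AbsRing C_R_NormedModule w t l <->
  is_derive (fun s => Re (w s)) t (Re l) /\
  is_derive (fun s => Im (w s)) t (Im l).
Proof.
  split.
  - intros H; split.
    + apply (filterdiff_comp' (V := C_R_NormedModule) (W := R_NormedModule)
               w (fun z : C => fst z) t _ (fun z : C => fst z) H).
      apply filterdiff_linear.
      apply (@is_linear_fst R_AbsRing R_NormedModule R_NormedModule).
    + apply (filterdiff_comp' (V := C_R_NormedModule) (W := R_NormedModule)
               w (fun z : C => snd z) t _ (fun z : C => snd z) H).
      apply filterdiff_linear.
      apply (@is_linear_snd R_AbsRing R_NormedModule R_NormedModule).
  - intros [Hu Hv].
    assert (E : forall a b : R,
      @plus C_R_NormedModule (@scal R_AbsRing C_R_NormedModule a (1, 0))
        (@scal R_AbsRing C_R_NormedModule b (0, 1)) = (a, b)).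
    { intros a b; change ((a * 1 + b * 0, a * 0 + b * 1) = (a, b));
        f_equal; ring. }
    apply is_derive_ext with (f := fun s =>
      @plus C_R_NormedModule
        (@scal R_AbsRing C_R_NormedModule (Re (w s)) (1, 0))
        (@scal R_AbsRing C_R_NormedModule (Im (w s)) (0, 1))).
    { intros s; rewrite E; unfold Re, Im; now destruct (w s). }
    replace l with (@plus C_R_NormedModule
        (@scal R_AbsRing C_R_NormedModule (Re l) (1, 0))
        (@scal R_AbsRing C_R_NormedModule (Im l) (0, 1)))
      by (rewrite E; unfold Re, Im; now destruct l).
    apply (@is_derive_plus R_AbsRing C_R_NormedModule);
      apply (@is_derive_scal_l R_AbsRing C_R_NormedModule); assumption.
Qed.

(* Conversely to the product rule, differentiability of [r] and [theta] follows
   from r = sqrt (u^2 + v^2) and from the local formula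
   theta = theta0 + atan ((v c0 - u s0) / (u c0 + v s0)), which holds because
   theta is continuous and thus stays within pi/2 of theta0. *)
Lemma is_derive_polar_iff (r theta : R -> R) (t dr dtheta : R) :
  locally t (fun s => 0 < r s) -> continuous theta t ->
  (is_derive (fun s => r s * cos (theta s)) t
     (dr * cos (theta t) - r t * dtheta * sin (theta t)) /\
   is_derive (fun s => r s * sin (theta s)) t
     (dr * sin (theta t) + r t * dtheta * cos (theta t))) <->
  (is_derive r t dr /\ is_derive theta t dtheta).
Proof.
  intros Hr Hc.
  assert (Hrt : 0 < r t) by exact (locally_singleton _ _ Hr).
  pose proof (sin2_cos2 (theta t)) as Hsc; unfold Rsqr in Hsc.
  split.
  - intros [Hu Hv].
    set (u := fun s : R => r s * cos (theta s)).
    set (v := fun s : R => r s * sin (theta s)).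
    set (c0 := cos (theta t)) in *; set (s0 := sin (theta t)) in *.
    change (is_derive u t (dr * c0 - r t * dtheta * s0)) in Hu.
    change (is_derive v t (dr * s0 + r t * dtheta * c0)) in Hv.
    assert (Eut : u t = r t * c0) by reflexivity.
    assert (Evt : v t = r t * s0) by reflexivity.
    assert (Du := is_derive_unique _ _ _ Hu).
    assert (Dv := is_derive_unique _ _ _ Hv).
    assert (Exu : ex_derive u t) by (eexists; exact Hu).
    assert (Exv : ex_derive v t) by (eexists; exact Hv).
    assert (Euv : u t * u t + v t * v t = r t * r t).
    { rewrite Eut, Evt.
      replace (r t * c0 * (r t * c0) + r t * s0 * (r t * s0))
        with (r t * r t * (s0 * s0 + c0 * c0)) by ring.
      rewrite Hsc; ring. }
    assert (Ew : u t * c0 + v t * s0 = r t).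
    { rewrite Eut, Evt.
      replace (r t * c0 * c0 + r t * s0 * s0)
        with (r t * (s0 * s0 + c0 * c0)) by ring.
      rewrite Hsc; ring. }
    assert (Ez : v t * c0 - u t * s0 = 0) by (rewrite Eut, Evt; ring).
    assert (Lr : locally t (fun s => sqrt (u s * u s + v s * v s) = r s)).
    { apply filter_imp with (2 := Hr); intros s Hs; unfold u, v.
      replace (r s * cos (theta s) * (r s * cos (theta s)) +
               r s * sin (theta s) * (r s * sin (theta s)))
        with (Rsqr (r s) * (Rsqr (sin (theta s)) + Rsqr (cos (theta s))))
        by (unfold Rsqr; ring).
      rewrite sin2_cos2, Rmult_1_r; apply sqrt_Rsqr; lra. }
    assert (Lt : locally t (fun s =>
      theta t + atan ((v s * c0 - u s * s0) / (u s * c0 + v s * s0)) =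
      theta s)).
    { assert (Hn : locally t (fun s => Rabs (theta s - theta t) < PI / 2)).
      { apply (Hc (fun y => Rabs (y - theta t) < PI / 2)).
        assert (H2 : 0 < PI / 2) by (pose proof PI_RGT_0; lra).
        exists (mkposreal _ H2); intros y Hy; exact Hy. }
      generalize (filter_and _ _ Hr Hn); apply filter_imp.
      intros s [Hs Ha]; apply Rabs_def2 in Ha.
      assert (Hcos : 0 < cos (theta s - theta t)) by (apply cos_gt_0; lra).
      (* By the subtraction formulas the numerator is r sin (theta s - theta t) and the denominator
         is r cos (theta s - theta t). *)
      replace ((v s * c0 - u s * s0) / (u s * c0 + v s * s0))
        with (tan (theta s - theta t)).
      { rewrite atan_tan by lra; ring. }
      unfold tan; rewrite cos_minus in Hcos |- *; rewrite sin_minus.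
      unfold u, v; fold c0 s0; fold c0 s0 in Hcos.
      field; split; [|lra].
      replace (r s * cos (theta s) * c0 + r s * sin (theta s) * s0)
        with (r s * (cos (theta s) * c0 + sin (theta s) * s0)) by ring.
      apply Rgt_not_eq, Rmult_lt_0_compat; assumption. }
    (* From here u and v are opaque, so that [auto_derive] uses their known derivatives instead of
       asking for those of r and theta. *)
    clearbody u v c0 s0.
    split.
    + apply is_derive_ext_loc with (1 := Lr).
      auto_derive.
      { repeat split; auto. rewrite Euv; nra. }
      change (Derive (fun x => u x) t) with (Derive u t).
      change (Derive (fun x => v x) t) with (Derive v t).
      rewrite Du, Dv, Euv, sqrt_square by lra.
      rewrite Eut, Evt.
      (* The derivative of the square root is (u u' + v v') / r; the terms in dtheta cancel. *)
      transitivity (dr * (s0 * s0 + c0 * c0)); [field; lra|].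
      rewrite Hsc; ring.
    + apply is_derive_ext_loc with (1 := Lt).
      auto_derive.
      { repeat split; auto. rewrite Ew; lra. }
      change (Derive (fun x => u x) t) with (Derive u t).
      change (Derive (fun x => v x) t) with (Derive v t).
      unfold Rminus in Ez |- *.
      rewrite Du, Dv, Ew, Ez.
      (* The numerator of the quotient vanishes at t, where the arctangent has slope 1; what remains
         is (v' c0 - u' s0) / r. *)
      transitivity (dtheta * (s0 * s0 + c0 * c0)); [field; lra|].
      rewrite Hsc; ring.
  - intros [Hdr Hdt].
    assert (Dr := is_derive_unique _ _ _ Hdr).
    assert (Dt := is_derive_unique _ _ _ Hdt).
    assert (Exr : ex_derive r t) by (eexists; exact Hdr).
    assert (Ext : ex_derive theta t) by (eexists; exact Hdt).
    split; auto_derive; auto;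
      change (Derive (fun x => r x) t) with (Derive r t);
      change (Derive (fun x => theta x) t) with (Derive theta t);
      rewrite Dr, Dt; ring.
Qed.

Lemma Rpower_pred (r n : R) : 0 < r -> Rpower r n = r * Rpower r (n - 1).
Proof.
  intros Hr; rewrite <- (Rpower_1 r Hr) at 2; rewrite <- Rpower_plus.
  f_equal; ring.
Qed.

(** * The complex equation and the polar system *)

Lemma complex_bernoulli_polar_iff
  (n : R) (a1 a2 : R -> R) (w : R -> C) (r theta : R -> R) (t : R) :
  locally t (fun s => 0 < r s) ->
  locally t (fun s => w s = (RtoC (r s) * Cexp (Ci * RtoC (theta s)))%C) ->
  continuous theta t ->
  complex_bernoulli_at n a1 a2 theta w t <->
  polar_bernoulli_at n a1 a2 r theta t.
Proof.
  intros Hr Hw Hc.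
  assert (Hrt : 0 < r t) by exact (locally_singleton _ _ Hr).
  unfold polar_bernoulli_at; rewrite <- is_derive_polar_iff by assumption.
  unfold complex_bernoulli_at; rewrite is_derive_C_iff.
  rewrite (locally_singleton _ _ Hw), polarE, Cpow_arg_polar by assumption.
  (* Splitting off e^(i theta) gives the right-hand side the shape dr cos - r dtheta sin, dr sin + r
     dtheta cos required by [is_derive_polar_iff]. *)
  replace (n * theta t) with ((n - 1) * theta t + theta t) by ring.
  rewrite cos_plus, sin_plus, (Rpower_pred (r t) n) by assumption.
  match goal with |- (is_derive _ _ ?x /\ is_derive _ _ ?y) <->
                     (is_derive _ _ ?x' /\ is_derive _ _ ?y') =>
    replace x with x' by (unfold RtoC, Cmult, Cplus, Re; simpl; ring);
    replace y with y' by (unfold RtoC, Cmult, Cplus, Im; simpl; ring)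
  end.
  assert (Lu : locally t (fun s => Re (w s) = r s * cos (theta s))).
  { apply filter_imp with (2 := Hw); intros s ->; now rewrite polarE. }
  assert (Lv : locally t (fun s => Im (w s) = r s * sin (theta s))).
  { apply filter_imp with (2 := Hw); intros s ->; now rewrite polarE. }
  split; intros [H1 H2]; split.
  - apply is_derive_ext_loc with (1 := Lu), H1.
  - apply is_derive_ext_loc with (1 := Lv), H2.
  - apply is_derive_ext_loc with (2 := H1).
    apply filter_imp with (2 := Lu); intros s ->; reflexivity.
  - apply is_derive_ext_loc with (2 := H2).
    apply filter_imp with (2 := Lv); intros s ->; reflexivity.
Qed.

(** * Verification of the explicit solution *)

(** Here the choice of root enters: 1 + 1/A^2 = (1 + A^2) / A^2 has the root sqrt (1 + A^2) / (- A),
    because A is negative. *)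
Lemma cos_atan_inv_neg (A : R) : A < 0 ->
  cos (- atan (1 / A)) = - A / sqrt (1 + A ^ 2).
Proof.
  intros HA; rewrite cos_neg, cos_atan.
  replace (1 + Rsqr (1 / A)) with ((1 + A ^ 2) / Rsqr (- A))
    by (unfold Rsqr; field; lra).
  rewrite sqrt_div, sqrt_Rsqr by (unfold Rsqr; nra).
  field; split; [|lra]. apply Rgt_not_eq, sqrt_lt_R0; nra.
Qed.

Lemma sin_atan_inv_neg (A : R) : A < 0 ->
  sin (- atan (1 / A)) = 1 / sqrt (1 + A ^ 2).
Proof.
  intros HA; rewrite sin_neg, sin_atan.
  replace (1 + Rsqr (1 / A)) with ((1 + A ^ 2) / Rsqr (- A))
    by (unfold Rsqr; field; lra).
  rewrite sqrt_div, sqrt_Rsqr by (unfold Rsqr; nra).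
  field; split; [|lra]. apply Rgt_not_eq, sqrt_lt_R0; nra.
Qed.

(** The integrals are abstracted to functions g and J of which only the derivatives at t matter; the
    rest is the chain rule. *)
Lemma polar_bernoulli_of_primitives
  (n c1 : R) (a1 a2 g J : R -> R) (t : R) :
  n <> 1 -> 0 < c1 ->
  is_derive g t ((n - 1) * a1 t) ->
  is_derive J t (exp (g t) * a2 t) ->
  (n - 1) * c1 * J t < 0 ->
  polar_bernoulli_at n a1 a2
    (fun s => Rpower (c1 * exp (g s) /
                      sqrt (1 + (n - 1) ^ 2 * c1 ^ 2 * J s ^ 2)) (1 / (n - 1)))
    (fun s => - (1 / (n - 1)) * atan (1 / ((n - 1) * c1 * J s))) t.
Proof.
  intros Hn Hc1 Hg HJ HA.
  assert (Hm : n - 1 <> 0) by lra.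
  assert (HJ0 : J t <> 0) by (intros E; rewrite E in HA; lra).
  assert (Dg := is_derive_unique _ _ _ Hg).
  assert (DJ := is_derive_unique _ _ _ HJ).
  assert (Exg : ex_derive g t) by (eexists; exact Hg).
  assert (ExJ : ex_derive J t) by (eexists; exact HJ).
  unfold polar_bernoulli_at; cbv beta.
  replace ((n - 1) * (- (1 / (n - 1)) * atan (1 / ((n - 1) * c1 * J t))))
    with (- atan (1 / ((n - 1) * c1 * J t))) by (field; auto).
  rewrite cos_atan_inv_neg, sin_atan_inv_neg by assumption.
  rewrite (Rpower_pred _ n) by (unfold Rpower; apply exp_pos).
  rewrite Rpower_mult.
  replace (1 / (n - 1) * (n - 1)) with 1 by (field; auto).
  replace (1 + (n - 1) ^ 2 * c1 ^ 2 * J t ^ 2)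
    with (1 + ((n - 1) * c1 * J t) ^ 2) by ring.
  assert (HP : 0 < 1 + ((n - 1) * c1 * J t) ^ 2) by nra.
  assert (Hq := sqrt_lt_R0 _ HP).
  assert (Hqq := sqrt_sqrt _ (Rlt_le _ _ HP)).
  pose proof (exp_pos (g t)) as He.
  assert (Hb : 0 < c1 * exp (g t) / sqrt (1 + ((n - 1) * c1 * J t) ^ 2))
    by (apply Rdiv_lt_0_compat; [apply Rmult_lt_0_compat|]; assumption).
  rewrite (Rpower_1 _ Hb).
  set (A := (n - 1) * c1 * J t) in *.
  set (q := sqrt (1 + A ^ 2)) in *.
  (* The left side is the radicand with its powers unfolded, as it appears after [auto_derive]. *)
  assert (EA : 1 + (n - 1) * ((n - 1) * 1) * (c1 * (c1 * 1)) *
                (J t * (J t * 1)) = 1 + A ^ 2) by (unfold A; ring).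
  split.
  - set (f := fun s => c1 * exp (g s) /
                      sqrt (1 + (n - 1) ^ 2 * c1 ^ 2 * J s ^ 2)).
    assert (Ef : f t = c1 * exp (g t) / q) by (unfold f, q; now rewrite <- EA).
    (* Logarithmic derivative of f = r^(n-1): f' / f = g' - A A' / (1 + A^2). *)
    assert (Hf : is_derive f t (f t * ((n - 1) * a1 t -
       A * ((n - 1) * c1 * (exp (g t) * a2 t)) / (1 + A ^ 2)))).
    { rewrite Ef; unfold f; auto_derive.
      { rewrite EA; fold q; repeat split; auto; lra. }
      rewrite EA; fold q.
      change (Derive (fun x => g x) t) with (Derive g t).
      change (Derive (fun x => J x) t) with (Derive J t).
      rewrite Dg, DJ, <- Hqq; unfold A.
      field; lra. }
    rewrite <- Ef in Hb |- *.
    assert (Df := is_derive_unique _ _ _ Hf).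
    assert (Exf : ex_derive f t) by (eexists; exact Hf).
    (* As r is the power 1/(n-1) of f, r' = r f' / ((n-1) f), and only the derivative of f is
       needed. *)
    change (is_derive (fun s => Rpower (f s) (1 / (n - 1))) t
      (a1 t * Rpower (f t) (1 / (n - 1)) +
       a2 t * (Rpower (f t) (1 / (n - 1)) * f t) * (- A / q))).
    clearbody f.
    unfold Rpower; auto_derive.
    { auto. }
    change (Derive (fun x => f x) t) with (Derive f t).
    rewrite Df.
    rewrite Ef, <- Hqq.
    field. repeat split; lra.
  - auto_derive.
    { repeat split; auto. fold A; lra. }
    change (Derive (fun x => J x) t) with (Derive J t).
    rewrite DJ.
    (* Both sides equal A' / ((n-1) (1 + A^2)), with q^2 = 1 + A^2. *)
    transitivity (a2 t * c1 * exp (g t) / (q * q)); [|field; lra].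
    rewrite Hqq; unfold A; field.
    fold A; repeat split; lra.
Qed.

(** * Derivatives of the integrals, and the theorem *)

Lemma is_derive_RInt_upper (f : R -> R) (a t : R) :
  locally t (fun s => ex_RInt f a s) -> continuous f t ->
  is_derive (fun s => RInt f a s) t (f t).
Proof.
  intros Hex Hc; apply is_derive_RInt with a; [|exact Hc].
  apply filter_imp with (2 := Hex); intros s.
  apply (RInt_correct (V := R_CompleteNormedModule)).
Qed.

Theorem mainTheorem3
  (n : R) (a1 a2 : R -> R) (hn0 : n <> 0) (hn1 : n <> 1)
  (D : R -> Prop) (hD : open D) :
  (* the complex equation in polar coordinates *)
  (forall (w : R -> C) (r theta : R -> R),
     (forall t, D t -> 0 < r t) ->
     (forall t, D t -> w t = (RtoC (r t) * Cexp (Ci * RtoC (theta t)))%C) ->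
     (forall t, D t -> continuous theta t) ->
     forall t, D t ->
       (complex_bernoulli_at n a1 a2 theta w t <->
        polar_bernoulli_at n a1 a2 r theta t))
  /\
  (* the explicit solution *)
  (forall a c1 c2 : R,
     0 < c1 ->
     (forall t, D t -> ex_RInt a1 a t) ->
     (forall t, D t -> ex_RInt (fun s => exp (gamma n a1 a s) * a2 s) a t) ->
     (forall t, D t -> shifted_integral n a1 a2 a c2 t <> 0) ->
     (forall t, D t -> negative_root_at n a1 a2 a c1 c2 t) ->
     forall t, D t -> continuous a1 t -> continuous a2 t ->
       polar_bernoulli_at n a1 a2
         (r_sol n a1 a2 a c1 c2) (theta_sol n a1 a2 a c1 c2) t).

Proof.
  split.
  - intros w r theta Hr Hw Hc t Dt.
    (* Openness of D turns the hypotheses on D into local ones around t. *)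
    apply complex_bernoulli_polar_iff.
    + exact (filter_imp _ _ Hr (hD t Dt)).
    + exact (filter_imp _ _ Hw (hD t Dt)).
    + exact (Hc t Dt).
  - intros a c1 c2 Hc1 Hex1 Hex2 Hnz Hneg t Dt Ha1 Ha2.
    assert (Hg : is_derive (gamma n a1 a) t ((n - 1) * a1 t)).
    { apply is_derive_scal, is_derive_RInt_upper; [|exact Ha1].
      exact (filter_imp _ _ Hex1 (hD t Dt)). }
    apply polar_bernoulli_of_primitives; try assumption.
    + unfold shifted_integral.
      apply is_derive_ext with (f := fun s =>
        plus c2 (RInt (fun s => exp (gamma n a1 a s) * a2 s) a s)).
      { reflexivity. }
      rewrite <- (plus_zero_l (exp (gamma n a1 a t) * a2 t)).
      apply (is_derive_plus (fun _ => c2));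
        [apply (is_derive_const (V := R_NormedModule))|].
      apply (is_derive_RInt_upper (fun s => exp (gamma n a1 a s) * a2 s)).
      { exact (filter_imp _ _ Hex2 (hD t Dt)). }
      apply (continuous_mult (fun s => exp (gamma n a1 a s)) a2);
        [|exact Ha2].
      apply continuous_comp.
      * apply (ex_derive_continuous (V := R_NormedModule)); eexists; exact Hg.
      * apply continuous_exp.
    (* A square root is nonnegative, so the negative root gives A <= 0; the inequality is strict
       since no factor of A vanishes. *)
    + assert (H := Hneg t Dt); unfold negative_root_at in H.
      assert (Hp := sqrt_pos ((n - 1) ^ 2 * c1 ^ 2 *
                              shifted_integral n a1 a2 a c2 t ^ 2)).
      rewrite H in Hp.
      assert ((n - 1) * c1 * shifted_integral n a1 a2 a c2 t <> 0); [|lra].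
      apply Rmult_integral_contrapositive_currified; [|exact (Hnz t Dt)].
      apply Rmult_integral_contrapositive_currified; lra.
Qed.
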